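(* Let $\gamma_0,\gamma_1$ be nonzero real numbers. Let $\{\psi_t(x)\in\mathbb{C} : x\in\mathbb{Z}_{\ge 0}\}$, $t\ge 0$, be the probability amplitude of the continuous-time quantum walk on the half line $\mathbb{Z}_{\ge 0}=\{0,1,2,\ldots\}$ with parameters $\gamma_0,\gamma_1$, started from the localized initial state $\psi_0(0)=1$ and $\psi_0(x)=0$ for $x=1,2,\ldots$. Let $X_t$ denote the position of the walker at time $t$, so that $\mathbb{P}(X_t=x)=|\psi_t(x)|^2$. Then for every $n=0,1,2,\ldots$ the following limits exist and $$\lim_{t\to\infty}\mathbb{P}(X_t=2n)=\begin{cases}\left\{1-\left(\dfrac{\gamma_0}{\gamma_1}\right)^2\right\}^2\left(\dfrac{\gamma_0}{\gamma_1}\right)^{2n} & \text{if } |\gamma_0|<|\gamma_1|,\\[3mm] 0 & \text{if } |\gamma_0|\ge|\gamma_1|,\end{cases}$$ $$\lim_{t\to\infty}\mathbb{P}(X_t=2n+1)=0.$$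
   Context: The continuous-time quantum walk on $\mathbb{Z}_{\ge 0}$ with parameters $\gamma_0,\gamma_1\in\mathbb{R}\setminus\{0\}$ evolves according to the Schrödinger equation (with $i$ the imaginary unit) $$i\,\frac{d}{dt}\psi_t(0)=\gamma_0\,\psi_t(1),$$ $$i\,\frac{d}{dt}\psi_t(2n)=\gamma_1\,\psi_t(2n-1)+\gamma_0\,\psi_t(2n+1)\qquad(n=1,2,\ldots),$$ $$i\,\frac{d}{dt}\psi_t(2n+1)=\gamma_0\,\psi_t(2n)+\gamma_1\,\psi_t(2n+2)\qquad(n=0,1,2,\ldots).$$ Equivalently, $i\frac{d}{dt}\psi_t=H\psi_t$, where the Hamiltonian $H$ is the bounded self-adjoint operator on $\ell^2(\mathbb{Z}_{\ge 0})$ given by the symmetric tridiagonal matrix with zero diagonal and entries $H_{2n,2n+1}=H_{2n+1,2n}=\gamma_0$, $H_{2n+1,2n+2}=H_{2n+2,2n+1}=\gamma_1$ for $n\ge 0$. The term ''probability amplitude'' means that $\psi_t\in\ell^2(\mathbb{Z}_{\ge 0})$ with $\sum_{x\ge 0}|\psi_t(x)|^2=1$ for all $t\ge 0$; thus $\psi_t=e^{-itH}\psi_0$. *)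

(* Defs.v *)
From Stdlib Require Import Reals Arith.
From Coquelicot Require Import Coquelicot.

Open Scope R_scope.

(* Derivative relative to the time domain [0, +oo): the ordinary derivative
   for t > 0, the right derivative at t = 0. *)
Definition is_time_derive (f : R -> C) (t : R) (l : C) : Prop :=
  filterdiff (U := R_NormedModule) (V := C_R_NormedModule)
    f (within (fun s => 0 <= s) (locally t)) (fun h => scal h l).

Definition i_ddt_is (f : R -> C) (t : R) (v : C) : Prop :=
  exists d : C, is_time_derive f t d /\ (Ci * d)%C = v.

(* [psi t x] is the amplitude at time t and site x; its values at negative
   times are left unconstrained. *)
Record is_ctqw (g0 g1 : R) (psi : R -> nat -> C) : Prop := {
  ctqw_zero : forall t, 0 <= t ->
    i_ddt_is (fun s => psi s 0%nat) t (g0 * psi t 1%nat)%C;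
  ctqw_even : forall t, 0 <= t -> forall n, (1 <= n)%nat ->
    i_ddt_is (fun s => psi s (2 * n)%nat) t
      (g1 * psi t (2 * n - 1)%nat + g0 * psi t (2 * n + 1)%nat)%C;
  ctqw_odd : forall t, 0 <= t -> forall n,
    i_ddt_is (fun s => psi s (2 * n + 1)%nat) t
      (g0 * psi t (2 * n)%nat + g1 * psi t (2 * n + 2)%nat)%C;
  ctqw_norm : forall t, 0 <= t ->
    is_series (fun x => Cmod (psi t x) ^ 2) 1
}.

Definition starts_at_origin (psi : R -> nat -> C) : Prop :=
  psi 0 0%nat = RtoC 1 /\ forall x, (1 <= x)%nat -> psi 0 x = RtoC 0.

(* The probability that the position at time t equals x. *)
Definition prob_position (psi : R -> nat -> C) (t : R) (x : nat) : R :=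
  Cmod (psi t x) ^ 2.

(* Main.v *)
(* Splitting amplitudes into real and imaginary parts gives two real solutions
   (a_n, b_n) of a_n' = g1 b_(n-1) + g0 b_n, b_n' = - c_n with
   c_n = g0 a_n + g1 a_(n+1), where a lives on the even and b on the odd sites.
   The odd sites obey b'' = - A b with A a Jacobi matrix with constant
   coefficients, and the momentum sum_n (b_(n+1) c_n - b_n c_(n+1)) has derivative
   - g0 g1 b_0^2; as it is bounded, b_0^2 is integrable.  All derivatives being
   bounded, a Landau-type lemma gives b_0 -> 0, then c_n -> 0 and b_n -> 0 for all
   n inductively.  Hence a_n ~ (- g0/g1)^n a_0.  If |g0| >= |g1|, the
   normalization forces a_0 -> 0; if |g0| < |g1|, the conserved overlap with the
   zero mode (- g0/g1)^n determines lim a_0. *)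

Require Import Defs.
From Stdlib Require Import Reals Arith Lra Lia.
From Coquelicot Require Import Coquelicot.

(** * Limits at infinity and elementary estimates *)

Lemma mean_value_pos (f g : R -> R) (s t : R) :
  0 < s -> s <= t -> (forall u, 0 < u -> is_derive f u (g u)) ->
  exists c, s <= c <= t /\ f t - f s = g c * (t - s).
Proof.
  intros Hs Hst Hd.
  destruct (MVT_gen f s t g) as [c [Hc Heq]].
  - rewrite Rmin_left by lra. intros x Hx. apply Hd. lra.
  - rewrite Rmin_left by lra. intros x Hx.
    apply continuity_pt_filterlim, (ex_derive_continuous f).
    exists (g x). apply Hd. lra.
  - rewrite Rmin_left, Rmax_right in Hc by lra. exists c. auto.
Qed.

Lemma derive_increment_le (f g : R -> R) (K s t : R) :
  0 < s -> s <= t ->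
  (forall u, 0 < u -> is_derive f u (g u)) ->
  (forall u, 0 < u -> Rabs (g u) <= K) ->
  Rabs (f t - f s) <= K * (t - s).
Proof.
  intros Hs Hst Hd HK.
  destruct (mean_value_pos f g s t Hs Hst Hd) as [c [Hc ->]].
  rewrite Rabs_mult, (Rabs_pos_eq (t - s)) by lra.
  apply Rmult_le_compat_r; [lra | apply HK; lra].
Qed.

(** Over a window of fixed length d the mean slope of [f] tends to 0, and somewhere in the window it
    equals a value of [g]; the bound on [h] keeps [g] within K d of that value. No integral is
    involved. *)
Lemma derive_lim_0 (f g h : R -> R) (K l : R) :
  (forall t, 0 < t -> is_derive f t (g t)) ->
  (forall t, 0 < t -> is_derive g t (h t)) ->
  (forall t, 0 < t -> Rabs (h t) <= K) ->
  is_lim f p_infty l -> is_lim g p_infty 0.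
Proof.
  intros Hf Hg HK Hl. apply is_lim_spec in Hl. apply is_lim_spec. intros eps.
  pose proof (cond_pos eps) as He.
  (* A strictly positive bound, so that the window length [d] can be defined by division. *)
  set (K' := Rabs K + 1).
  assert (HK' : 0 < K') by (unfold K'; pose proof (Rabs_pos K); lra).
  assert (HKK' : forall u, 0 < u -> Rabs (h u) <= K').
  { intros u Hu. specialize (HK u Hu). unfold K'. pose proof (Rle_abs K). lra. }
  set (d := eps / (2 * K')).
  assert (Hd : 0 < d) by (unfold d; apply Rdiv_lt_0_compat; lra).
  assert (HdK : K' * d = eps / 2) by (unfold d; field; lra).
  (* Two values of [f] this close to [l] differ by less than eps d / 2, so the mean slope is below
     eps / 2; the drift of [g] costs the other eps / 2. *)
  assert (Heta : 0 < eps * d / 4) by nra.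
  destruct (Hl (mkposreal _ Heta)) as [M HM]. simpl in HM.
  exists (Rmax M 0). intros t Ht.
  pose proof (Rmax_l M 0). pose proof (Rmax_r M 0).
  assert (H1 := HM t ltac:(lra)). assert (H2 := HM (t + d) ltac:(lra)).
  destruct (mean_value_pos f g t (t + d)) as [c [Hc Hmv]]; try lra; try assumption.
  assert (H3 := derive_increment_le g h K' t c ltac:(lra) ltac:(lra) Hg HKK').
    assert (H4 : K' * (c - t) <= eps / 2) by (rewrite <- HdK; nra).
    rewrite Rminus_0_r.
    replace (f (t + d) - f t) with ((f (t + d) - l) - (f t - l)) in Hmv by ring.
    replace (t + d - t) with d in Hmv by ring.
    apply Rabs_def2 in H1. apply Rabs_def2 in H2.
    assert (H5 : Rabs (g c) < eps / 2).
    { apply Rabs_def1; nra. }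
    assert (H6 : Rabs (g t) <= Rabs (g c) + Rabs (g c - g t)).
    { replace (g t) with (g c - (g c - g t)) at 1 by ring.
      eapply Rle_trans; [apply Rabs_triang|]. rewrite Rabs_Ropp. lra. }
    lra.
Qed.

Lemma monotone_bounded_lim (f : R -> R) (B : R) :
  (forall s t, 1 <= s -> s <= t -> f s <= f t) ->
  (forall t, 1 <= t -> f t <= B) ->
  exists l : R, is_lim f p_infty l.
Proof.
  intros Hm HB.
  destruct (completeness (fun y => exists t, 1 <= t /\ y = f t)) as [l [Hub Hlub]].
  - exists B. intros y [t [Ht ->]]. auto.
  - exists (f 1), 1. split; [lra | reflexivity].
  - exists l. apply is_lim_spec. intros eps. pose proof (cond_pos eps) as He.
    destruct (Classical_Prop.classic (exists s, 1 <= s /\ l - eps < f s))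
      as [[s [Hs Hfs]] | Hno].
    + exists s. intros t Ht.
      assert (f s <= f t) by (apply Hm; lra).
      assert (f t <= l) by (apply Hub; exists t; split; [lra | reflexivity]).
      apply Rabs_def1; lra.
    + exfalso. assert (l <= l - eps); [|lra].
      apply Hlub. intros y [t [Ht ->]].
      destruct (Rle_dec (f t) (l - eps)); [assumption|].
      exfalso. apply Hno. exists t. split; lra.
Qed.

Lemma is_lim_lincomb_0 (f g : R -> R) (x y : R) :
  is_lim f p_infty 0 -> is_lim g p_infty 0 ->
  is_lim (fun t => x * f t + y * g t) p_infty 0.
Proof.
  intros Hf Hg.
  replace (Finite 0) with (Finite (x * 0 + y * 0)) by (f_equal; ring).
  apply is_lim_plus'.
  - exact (is_lim_scal_l f x p_infty 0 Hf).
  - exact (is_lim_scal_l g y p_infty 0 Hg).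
Qed.

Lemma is_lim_sum_0 (F : nat -> R -> R) (N : nat) :
  (forall n, is_lim (F n) p_infty 0) ->
  is_lim (fun t => sum_f_R0 (fun n => F n t) N) p_infty 0.
Proof.
  intros HF. induction N as [|N IH]; simpl; [apply HF|].
  replace (Finite 0) with (Finite (0 + 0)) by (f_equal; ring).
  apply is_lim_plus'; auto.
Qed.

Lemma is_lim_sqr_0 (f : R -> R) :
  is_lim f p_infty 0 -> is_lim (fun t => f t ^ 2) p_infty 0.
Proof.
  intros Hf.
  replace (Finite 0) with (Finite (0 ^ 2)) by (f_equal; ring).
  apply (is_lim_comp_continuous f (fun x => x ^ 2) p_infty 0 Hf).
  apply (ex_derive_continuous (fun x => x ^ 2)). auto_derive. exact I.
Qed.

Lemma is_lim_of_sqr_0 (f : R -> R) :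
  is_lim (fun t => f t ^ 2) p_infty 0 -> is_lim f p_infty 0.
Proof.
  intros Hf. apply is_lim_spec in Hf. apply is_lim_spec. intros eps.
  pose proof (cond_pos eps) as He.
  assert (He2 : 0 < eps ^ 2) by nra.
  destruct (Hf (mkposreal _ He2)) as [M HM]. exists M. intros t Ht.
  specialize (HM t Ht). simpl pos in HM. apply Rabs_def2 in HM.
  rewrite Rminus_0_r in *. apply Rabs_def1; nra.
Qed.

Lemma sum_shift_le_1 (E : nat -> R) (k : nat) :
  (forall n, 0 <= E n) -> (forall N, sum_f_R0 E N <= 1) ->
  forall N, sum_f_R0 (fun n => E (n + k)%nat) N <= 1.
Proof.
  intros HE Hs. induction k as [|k IH]; intros N.
  - rewrite (sum_eq _ E); [apply Hs|]. intros; f_equal; lia.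
  - specialize (IH (S N)). rewrite decomp_sum in IH by lia. simpl in IH.
    rewrite (sum_eq _ (fun n => E (S (n + k)))); [|intros; f_equal; lia].
    specialize (HE k). lra.
Qed.

(** * The real system and its a priori bounds *)

Definition prev (b : nat -> R -> R) (n : nat) (t : R) : R :=
  match n with O => 0 | S m => b m t end.

(* Up to the phases [1, -i] on the even and odd sites, the walk splits into two
   real solutions of this system. *)
Record real_walk (g0 g1 : R) (a b : nat -> R -> R) : Prop := {
  rw_even : forall n t, 0 < t ->
    is_derive (a n) t (g1 * prev b n t + g0 * b n t);
  rw_odd : forall n t, 0 < t ->
    is_derive (b n) t (- (g0 * a n t + g1 * a (S n) t));
  rw_norm : forall N t, 0 < t ->
    sum_f_R0 (fun n => a n t ^ 2 + b n t ^ 2) N <= 1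
}.

Lemma rw_site_le (g0 g1 : R) (a b : nat -> R -> R) (n : nat) (t : R) :
  real_walk g0 g1 a b -> 0 < t -> a n t ^ 2 + b n t ^ 2 <= 1.
Proof.
  intros H Ht. destruct n as [|n].
  - exact (rw_norm _ _ _ _ H 0%nat t Ht).
  - pose proof (rw_norm _ _ _ _ H (S n) t Ht) as Hs. rewrite tech5 in Hs.
    assert (0 <= sum_f_R0 (fun k => a k t ^ 2 + b k t ^ 2) n).
    { apply cond_pos_sum. intros. nra. }
    lra.
Qed.

Lemma rw_even_le (g0 g1 : R) (a b : nat -> R -> R) (n : nat) (t : R) :
  real_walk g0 g1 a b -> 0 < t -> Rabs (a n t) <= 1.
Proof.
  intros H Ht. pose proof (rw_site_le _ _ _ _ n t H Ht).
  apply Rabs_le. split; nra.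
Qed.

Lemma rw_odd_le (g0 g1 : R) (a b : nat -> R -> R) (n : nat) (t : R) :
  real_walk g0 g1 a b -> 0 < t -> Rabs (b n t) <= 1.
Proof.
  intros H Ht. pose proof (rw_site_le _ _ _ _ n t H Ht).
  apply Rabs_le. split; nra.
Qed.

Lemma rw_prev_le (g0 g1 : R) (a b : nat -> R -> R) (n : nat) (t : R) :
  real_walk g0 g1 a b -> 0 < t -> Rabs (prev b n t) <= 1.
Proof.
  intros H Ht. destruct n; simpl.
  - rewrite Rabs_R0. lra.
  - eapply rw_odd_le; eauto.
Qed.

(** * Derivatives of the odd components *)

Definition flux (g0 g1 : R) (a : nat -> R -> R) (n : nat) (t : R) : R :=
  g0 * a n t + g1 * a (S n) t.

(** This is (A b)_n for the Jacobi matrix A with diagonal g0^2 + g1^2 and off-diagonal g0 g1. The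
    convention b_(-1) = 0 in [prev] makes row 0 fit the same formula. Since [flux] is - b_n', this
    gives b'' = - A b. *)
Definition dflux (g0 g1 : R) (b : nat -> R -> R) (n : nat) (t : R) : R :=
  (g0 ^ 2 + g1 ^ 2) * b n t + g0 * g1 * (prev b n t + b (S n) t).

Lemma rw_flux_derive (g0 g1 : R) (a b : nat -> R -> R) (n : nat) (t : R) :
  real_walk g0 g1 a b -> 0 < t ->
  is_derive (flux g0 g1 a n) t (dflux g0 g1 b n t).
Proof.
  intros H Ht. unfold flux.
  pose proof (rw_even _ _ _ _ H n t Ht) as H1.
  pose proof (rw_even _ _ _ _ H (S n) t Ht) as H2. simpl prev in H2.
  evar_last.
  - apply (is_derive_plus (fun t => g0 * a n t) (fun t => g1 * a (S n) t)).
    + apply is_derive_scal. exact H1.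
    + apply is_derive_scal. exact H2.
  - unfold dflux, plus; simpl. ring.
Qed.

Lemma lin_abs_le (x y u v : R) :
  Rabs u <= 1 -> Rabs v <= 1 -> Rabs (x * u + y * v) <= Rabs x + Rabs y.
Proof.
  intros Hu Hv. eapply Rle_trans; [apply Rabs_triang|]. rewrite !Rabs_mult.
  pose proof (Rabs_pos x). pose proof (Rabs_pos y). nra.
Qed.

Lemma rw_flux_le (g0 g1 : R) (a b : nat -> R -> R) (n : nat) (t : R) :
  real_walk g0 g1 a b -> 0 < t -> Rabs (flux g0 g1 a n t) <= Rabs g0 + Rabs g1.
Proof. intros H Ht. apply lin_abs_le; eapply rw_even_le; eauto. Qed.

Lemma rw_dflux_le (g0 g1 : R) (a b : nat -> R -> R) (n : nat) (t : R) :
  real_walk g0 g1 a b -> 0 < t ->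
  Rabs (dflux g0 g1 b n t) <= (Rabs g0 + Rabs g1) ^ 2.
Proof.
  intros H Ht. unfold dflux.
  assert (Hp := rw_prev_le _ _ _ _ n t H Ht).
  assert (Hn := rw_odd_le _ _ _ _ (S n) t H Ht).
  assert (H0 := rw_odd_le _ _ _ _ n t H Ht).
  (* Averaging the two neighbours gives a quantity bounded by 1, and the factor 2 becomes the cross
     term of (|g0| + |g1|)^2. *)
  replace (g0 * g1 * (prev b n t + b (S n) t))
    with (2 * g0 * g1 * ((prev b n t + b (S n) t) / 2)) by field.
  eapply Rle_trans.
  - apply lin_abs_le; [exact H0|].
    apply Rabs_le. apply Rabs_le_between in Hp, Hn. lra.
  - rewrite (Rabs_pos_eq (_ + _)) by nra. rewrite !Rabs_mult, (Rabs_pos_eq 2) by lra.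
    replace ((Rabs g0 + Rabs g1) ^ 2)
      with (Rabs g0 ^ 2 + Rabs g1 ^ 2 + 2 * Rabs g0 * Rabs g1) by ring.
    rewrite !pow2_abs. lra.
Qed.

Lemma rw_flux_lim (g0 g1 : R) (a b : nat -> R -> R) (n : nat) :
  real_walk g0 g1 a b -> is_lim (b n) p_infty 0 ->
  is_lim (flux g0 g1 a n) p_infty 0.
Proof.
  intros H Hb.
  apply (derive_lim_0 (fun t => (-1) * b n t) _ (dflux g0 g1 b n)
           ((Rabs g0 + Rabs g1) ^ 2) 0).
  - intros t Ht. evar_last.
    + apply is_derive_scal. exact (rw_odd _ _ _ _ H n t Ht).
    + unfold flux. ring.
  - intros t Ht. apply rw_flux_derive with (1 := H) (2 := Ht).
  - intros t Ht. apply rw_dflux_le with (1 := H) (2 := Ht).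
  - replace (Finite 0) with (Rbar_mult (-1) 0)
      by (simpl; f_equal; ring).
    apply is_lim_scal_l. exact Hb.
Qed.

(** The Landau argument one derivative higher: [flux] tends to 0, and the derivative of [dflux] is -
    A applied to the fluxes, hence bounded. *)
Lemma rw_dflux_lim (g0 g1 : R) (a b : nat -> R -> R) (n : nat) :
  real_walk g0 g1 a b -> is_lim (b n) p_infty 0 ->
  is_lim (dflux g0 g1 b n) p_infty 0.
Proof.
  intros H Hb.
  apply (derive_lim_0 (flux g0 g1 a n) _
     (fun t => - ((g0 ^ 2 + g1 ^ 2) * flux g0 g1 a n t
        + g0 * g1 * (prev (flux g0 g1 a) n t + flux g0 g1 a (S n) t)))
     ((Rabs g0 + Rabs g1) ^ 3) 0).
  - intros t Ht. apply rw_flux_derive with (1 := H) (2 := Ht).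
  - intros t Ht. unfold dflux.
    assert (Hb' : forall m, is_derive (b m) t (- flux g0 g1 a m t)).
    { intros m. exact (rw_odd _ _ _ _ H m t Ht). }
    assert (Hp : is_derive (prev b n) t (- prev (flux g0 g1 a) n t)).
    { destruct n; simpl; [|apply Hb'].
      rewrite Ropp_0. apply (is_derive_const 0 t). }
    evar_last.
    + apply (is_derive_plus (fun t => (g0 ^ 2 + g1 ^ 2) * b n t)
               (fun t => g0 * g1 * (prev b n t + b (S n) t))).
      * apply is_derive_scal. apply Hb'.
      * apply is_derive_scal.
        apply (is_derive_plus (prev b n) (b (S n)) t _ _ Hp (Hb' (S n))).
    + unfold plus; simpl. ring.
  - intros t Ht. rewrite Rabs_Ropp.
    assert (Hf := rw_flux_le _ _ _ _ n t H Ht).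
    assert (Hn := rw_flux_le _ _ _ _ (S n) t H Ht).
    assert (Hp : Rabs (prev (flux g0 g1 a) n t) <= Rabs g0 + Rabs g1).
    { destruct n; simpl prev; [|eapply rw_flux_le; eauto].
      rewrite Rabs_R0. pose proof (Rabs_pos g0). pose proof (Rabs_pos g1). lra. }
    eapply Rle_trans; [apply Rabs_triang|].
    rewrite !Rabs_mult.
    pose proof (Rabs_triang (prev (flux g0 g1 a) n t) (flux g0 g1 a (S n) t)) as Ht3.
    rewrite (Rabs_pos_eq (_ ^ 2 + _)) by nra.
    rewrite <- (pow2_abs g0), <- (pow2_abs g1).
    pose proof (Rabs_pos g0). pose proof (Rabs_pos g1).
    set (x := Rabs g0) in *. set (y := Rabs g1) in *.
    replace ((x + y) ^ 3) with ((x ^ 2 + y ^ 2) * (x + y) + x * y * (2 * (x + y))) by ring.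
    apply Rplus_le_compat; apply Rmult_le_compat_l; nra.
  - apply rw_flux_lim with (1 := H) (2 := Hb).
Qed.

(** * Momentum balance and integrability of b_0^2 *)

Definition current (g0 g1 : R) (a b : nat -> R -> R) (n : nat) (t : R) : R :=
  b (S n) t * flux g0 g1 a n t - b n t * flux g0 g1 a (S n) t.

(** Since b_n' = - c_n, [current] is the Wronskian b_n b_(n+1)' - b_(n+1) b_n'. In its derivative
    the constant diagonal of A cancels, and what remains is g0 g1 times an increment of [defect]. At
    n = 0 the defect is b_0^2. *)
Definition defect (b : nat -> R -> R) (n : nat) (t : R) : R :=
  b n t ^ 2 - b (S n) t * prev b n t.

(* The currents telescope: the derivative of the sum over [n <= N] only involves
   [b O] and a boundary defect at [N + 1], which averaging over [N <= K] makes
   [O(1/K)] by the normalization; this replaces the limit [N -> oo]. *)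
Lemma rw_current_derive (g0 g1 : R) (a b : nat -> R -> R) (n : nat) (t : R) :
  real_walk g0 g1 a b -> 0 < t ->
  is_derive (current g0 g1 a b n) t
    (g0 * g1 * (defect b (S n) t - defect b n t)).
Proof.
  intros H Ht.
  pose proof (rw_odd _ _ _ _ H n t Ht) as Hb0.
  pose proof (rw_odd _ _ _ _ H (S n) t Ht) as Hb1.
  pose proof (rw_flux_derive _ _ _ _ n t H Ht) as Hc0.
  pose proof (rw_flux_derive _ _ _ _ (S n) t H Ht) as Hc1.
  unfold current. evar_last.
  - apply (is_derive_minus (fun t => b (S n) t * flux g0 g1 a n t)
             (fun t => b n t * flux g0 g1 a (S n) t)).
    + apply (is_derive_mult (b (S n)) (flux g0 g1 a n)); eauto. exact Rmult_comm.
    + apply (is_derive_mult (b n) (flux g0 g1 a (S n))); eauto. exact Rmult_comm.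
  - unfold dflux, defect, flux, minus, plus, opp, mult; simpl. ring.
Qed.

Lemma rw_current_sum_derive (g0 g1 : R) (a b : nat -> R -> R) (N : nat) (t : R) :
  real_walk g0 g1 a b -> 0 < t ->
  is_derive (fun t => sum_f_R0 (fun n => current g0 g1 a b n t) N) t
    (g0 * g1 * (defect b (S N) t - b O t ^ 2)).
Proof.
  intros H Ht. induction N as [|N IH].
  - evar_last; [apply rw_current_derive with (1 := H) (2 := Ht)|].
    unfold defect; simpl. ring.
  - simpl sum_f_R0. evar_last.
    + apply (is_derive_plus
        (fun t => sum_f_R0 (fun n => current g0 g1 a b n t) N)
        (current g0 g1 a b (S N))); [exact IH|].
      apply rw_current_derive with (1 := H) (2 := Ht).
    + unfold plus; simpl. ring.
Qed.

Lemma rw_current_sum_sum_derive (g0 g1 : R) (a b : nat -> R -> R) (K : nat) (t : R) :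
  real_walk g0 g1 a b -> 0 < t ->
  is_derive
    (fun t => sum_f_R0 (fun N => sum_f_R0 (fun n => current g0 g1 a b n t) N) K) t
    (g0 * g1 * (sum_f_R0 (fun N => defect b (S N) t) K - INR (S K) * b O t ^ 2)).
Proof.
  intros H Ht. induction K as [|K IH].
  - evar_last; [apply rw_current_sum_derive with (1 := H) (2 := Ht)|].
    simpl. ring.
  - rewrite S_INR. evar_last.
    + apply (is_derive_plus
        (fun t => sum_f_R0 (fun N => sum_f_R0 (fun n => current g0 g1 a b n t) N) K)
        (fun t => sum_f_R0 (fun n => current g0 g1 a b n t) (S K))); [exact IH|].
      apply rw_current_sum_derive with (1 := H) (2 := Ht).
    + rewrite tech5. unfold plus; simpl. ring.
Qed.

Lemma rw_window_sum_le (g0 g1 : R) (a b : nat -> R -> R) (k N : nat) (t : R) :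
  real_walk g0 g1 a b -> 0 < t ->
  sum_f_R0 (fun n => a (n + k)%nat t ^ 2 + b (n + k)%nat t ^ 2) N <= 1.
Proof.
  intros H Ht.
  apply (sum_shift_le_1 (fun n => a n t ^ 2 + b n t ^ 2)).
  - intros n. nra.
  - intros M. exact (rw_norm _ _ _ _ H M t Ht).
Qed.

(** Each of the three shifted sums of [E] is at most 1. This turns local quadratic estimates into
    bounds uniform in the number of terms. *)
Lemma sum_abs_le_window (E u : nat -> R) (c : R) (N : nat) :
  0 <= c ->
  (forall k, sum_f_R0 (fun n => E (n + k)%nat) N <= 1) ->
  (forall n, Rabs (u n) <= c * (E n + E (n + 1)%nat + E (n + 2)%nat)) ->
  Rabs (sum_f_R0 u N) <= 3 * c.
Proof.
  intros Hc HE Hu.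
  eapply Rle_trans; [apply Rsum_abs|].
  eapply Rle_trans; [apply sum_Rle; intros n _; apply Hu|].
  rewrite (sum_eq _ (fun n => (E n + E (n + 1)%nat + E (n + 2)%nat) * c))
    by (intros; ring).
  rewrite <- scal_sum, !sum_plus.
  pose proof (HE 0%nat) as H0. pose proof (HE 1%nat). pose proof (HE 2%nat).
  rewrite (sum_eq _ E) in H0 by (intros; f_equal; lia).
  nra.
Qed.

Lemma rw_defect_sum_le (g0 g1 : R) (a b : nat -> R -> R) (N : nat) (t : R) :
  real_walk g0 g1 a b -> 0 < t ->
  Rabs (sum_f_R0 (fun n => defect b (S n) t) N) <= 3.
Proof.
  intros H Ht. replace 3 with (3 * 1) by ring.
  apply (sum_abs_le_window (fun n => a n t ^ 2 + b n t ^ 2)); [lra| |].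
  - intros k. exact (rw_window_sum_le _ _ _ _ k N t H Ht).
  - intros n. unfold defect. simpl prev.
    replace (n + 1)%nat with (S n) by lia. replace (n + 2)%nat with (S (S n)) by lia.
    apply Rabs_le. split; nra.
Qed.

Lemma rw_current_sum_le (g0 g1 : R) (a b : nat -> R -> R) (N : nat) (t : R) :
  real_walk g0 g1 a b -> 0 < t ->
  Rabs (sum_f_R0 (fun n => current g0 g1 a b n t) N) <= 3 * (1 + g0 ^ 2 + g1 ^ 2).
Proof.
  intros H Ht.
  apply (sum_abs_le_window (fun n => a n t ^ 2 + b n t ^ 2)); [nra| |].
  - intros k. exact (rw_window_sum_le _ _ _ _ k N t H Ht).
  - intros n. unfold current, flux.
    replace (n + 1)%nat with (S n) by lia. replace (n + 2)%nat with (S (S n)) by lia.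
    set (a0 := a n t). set (a1 := a (S n) t). set (a2 := a (S (S n)) t).
    set (b0 := b n t). set (b1 := b (S n) t). set (b2 := b (S (S n)) t).
    (* Cauchy-Schwarz; by Lagrange's identity the gap is (g0 y - g1 x)^2. *)
    assert (HC : forall x y, (g0 * x + g1 * y) ^ 2 <= (g0 ^ 2 + g1 ^ 2) * (x ^ 2 + y ^ 2)).
    { intros x y. pose proof (pow2_ge_0 (g0 * y - g1 * x)). nra. }
    assert (H0 := HC a0 a1). assert (H1 := HC a1 a2).
    set (c0 := g0 * a0 + g1 * a1) in *. set (c1 := g0 * a1 + g1 * a2) in *.
    set (s := g0 ^ 2 + g1 ^ 2) in *.
    assert (Hs : 0 <= s) by (unfold s; nra).
    replace (1 + g0 ^ 2 + g1 ^ 2) with (1 + s) by (unfold s; ring).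
    assert (Rabs (b1 * c0 - b0 * c1) <= (b0 ^ 2 + b1 ^ 2 + c0 ^ 2 + c1 ^ 2) / 2).
    { pose proof (pow2_ge_0 (b1 + c0)). pose proof (pow2_ge_0 (b1 - c0)).
      pose proof (pow2_ge_0 (b0 + c1)). pose proof (pow2_ge_0 (b0 - c1)).
      apply Rabs_le. split; lra. }
    assert (0 <= s * b0 ^ 2) by nra. assert (0 <= s * b1 ^ 2) by nra.
    assert (0 <= s * b2 ^ 2) by nra. assert (0 <= s * a0 ^ 2) by nra.
    assert (0 <= s * a1 ^ 2) by nra. assert (0 <= s * a2 ^ 2) by nra.
    pose proof (pow2_ge_0 b2). pose proof (pow2_ge_0 a0). pose proof (pow2_ge_0 a1).
    pose proof (pow2_ge_0 a2). pose proof (pow2_ge_0 b0). pose proof (pow2_ge_0 b1).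
    lra.
Qed.

Lemma rw_current_sum_sum_le (g0 g1 : R) (a b : nat -> R -> R) (K : nat) (t : R) :
  real_walk g0 g1 a b -> 0 < t ->
  Rabs (sum_f_R0 (fun N => sum_f_R0 (fun n => current g0 g1 a b n t) N) K)
  <= 3 * (1 + g0 ^ 2 + g1 ^ 2) * INR (S K).
Proof.
  intros H Ht. eapply Rle_trans; [apply Rsum_abs|].
  rewrite <- sum_cte. apply sum_Rle. intros n _.
  apply rw_current_sum_le with (1 := H) (2 := Ht).
Qed.

(** The point is that the bound does not depend on [t]. The double sum of currents is O(K) and loses
    g0 g1 (K + 1) b_0^2 per unit time, up to a defect sum bounded independently of K; dividing by K
    + 1 leaves a constant plus O(t / K), and K may depend on [t]. *)
Lemma rw_origin_energy_le (g0 g1 : R) (a b : nat -> R -> R) (G : R -> R) (t : R) :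
  g0 <> 0 -> g1 <> 0 -> real_walk g0 g1 a b ->
  (forall u, 0 < u -> is_derive G u (b O u ^ 2)) -> 1 <= t ->
  G t <= G 1 + (6 * (1 + g0 ^ 2 + g1 ^ 2) + 1) / Rabs (g0 * g1).
Proof.
  intros h0 h1 H HG Ht.
  set (B := g0 * g1).
  assert (HB : 0 < Rabs B).
  { apply Rabs_pos_lt. apply Rmult_integral_contrapositive; auto. }
  set (kap := 3 * (1 + g0 ^ 2 + g1 ^ 2)).
  (* K exceeds the total defect contribution over [1, t], which then adds at most 1 after division
     by K + 1. *)
  destruct (INR_archimed 1 (3 * Rabs B * (t - 1))) as [K HK]; [lra|].
  set (P := fun t => sum_f_R0
    (fun N => sum_f_R0 (fun n => current g0 g1 a b n t) N) K).
  (* Adding this multiple of [G] cancels the b_0^2 term in the derivative of [P], leaving only the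
     defects. *)
  set (f := fun t => P t + B * INR (S K) * G t).
  assert (Hf : Rabs (f t - f 1) <= 3 * Rabs B * (t - 1)).
  { apply (derive_increment_le f
      (fun u => B * sum_f_R0 (fun N => defect b (S N) u) K)); [lra | lra | |].
    - intros u Hu. unfold f. evar_last.
      + apply (is_derive_plus P (fun t => B * INR (S K) * G t)).
        * apply rw_current_sum_sum_derive with (1 := H) (2 := Hu).
        * apply is_derive_scal. apply HG. exact Hu.
      + unfold B, plus. cbn -[INR sum_f_R0 pow]. ring.
    - intros u Hu. rewrite Rabs_mult, (Rmult_comm 3).
      apply Rmult_le_compat_l; [lra|].
      apply rw_defect_sum_le with (1 := H) (2 := Hu). }
  assert (HP1 := rw_current_sum_sum_le _ _ _ _ K 1 H ltac:(lra)).
  assert (HPt := rw_current_sum_sum_le _ _ _ _ K t H ltac:(lra)).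
  fold (P 1) in HP1. fold (P t) in HPt. fold kap in HP1, HPt.
  assert (HS : 0 < INR (S K)) by (apply lt_0_INR; lia).
  assert (Hkey : Rabs B * INR (S K) * (G t - G 1) <= (2 * kap + 1) * INR (S K)).
  { eapply Rle_trans.
    - rewrite <- (Rabs_pos_eq (INR (S K))), <- Rabs_mult by lra.
      eapply Rle_trans; [apply Rmult_le_compat_l; [apply Rabs_pos | apply Rle_abs]|].
      rewrite <- Rabs_mult.
      replace (B * INR (S K) * (G t - G 1)) with ((f t - f 1) + (P 1 - P t))
        by (unfold f; ring).
      apply Rabs_triang.
    - pose proof (Rabs_triang (P 1) (- P t)) as HPP. rewrite Rabs_Ropp in HPP.
      unfold Rminus at 2. rewrite S_INR in *. lra. }
  assert (Hdiv : Rabs B * (G t - G 1) <= 2 * kap + 1) by nra.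
  replace (6 * (1 + g0 ^ 2 + g1 ^ 2) + 1) with (2 * kap + 1) by (unfold kap; ring).
  assert (G t - G 1 <= (2 * kap + 1) / Rabs B); [|lra].
  apply Rle_div_r; [lra|]. rewrite Rmult_comm. exact Hdiv.
Qed.

(** * Decay on the odd sites *)

Lemma rw_first_odd_lim (g0 g1 : R) (a b : nat -> R -> R) :
  g0 <> 0 -> g1 <> 0 -> real_walk g0 g1 a b -> is_lim (b O) p_infty 0.
Proof.
  intros h0 h1 H. apply is_lim_of_sqr_0.
  set (h := fun t => 2 * b O t * - flux g0 g1 a 0 t).
  assert (Hder : forall t, 0 < t -> is_derive (fun t => b O t ^ 2) t (h t)).
  { intros t Ht. evar_last.
    - apply is_derive_pow. exact (rw_odd _ _ _ _ H 0%nat t Ht).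
    - unfold h, flux. simpl. ring. }
  (* The base point is 1 because the equations of [real_walk] hold only at positive times. *)
  set (G := fun t => RInt (fun u => b O u ^ 2) 1 t).
  assert (Hcont : forall t, 0 < t -> continuous (fun u => b O u ^ 2) t).
  { intros t Ht. apply (ex_derive_continuous (fun u => b O u ^ 2)).
    exists (h t). auto. }
  assert (HG : forall t, 0 < t -> is_derive G t (b O t ^ 2)).
  { intros t Ht. apply (is_derive_RInt (fun u => b O u ^ 2) G 1 t); [|auto].
    exists (mkposreal t Ht). intros y Hy.
    apply Rabs_def2 in Hy. unfold minus, plus, opp in Hy; simpl in Hy.
    apply (RInt_correct (fun u => b O u ^ 2)).
    apply (ex_RInt_continuous (fun u => b O u ^ 2)). intros z Hz. apply Hcont.
    pose proof (Rmin_glb_lt 1 y 0). lra. }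
  destruct (monotone_bounded_lim G
    (G 1 + (6 * (1 + g0 ^ 2 + g1 ^ 2) + 1) / Rabs (g0 * g1))) as [l Hl].
  - intros s t Hs Hst.
    destruct (mean_value_pos G (fun u => b O u ^ 2) s t) as [c [_ Hc]];
      [lra | lra | exact HG |].
    pose proof (pow2_ge_0 (b O c)). nra.
  - intros t Ht.
    exact (rw_origin_energy_le _ _ _ _ G t h0 h1 H HG Ht).
  - apply (derive_lim_0 G _ h (2 * (Rabs g0 + Rabs g1)) l HG Hder); [|exact Hl].
    intros t Ht. unfold h. rewrite !Rabs_mult, Rabs_Ropp, (Rabs_pos_eq 2) by lra.
    pose proof (rw_odd_le _ _ _ _ 0 t H Ht). pose proof (rw_flux_le _ _ _ _ 0 t H Ht).
    pose proof (Rabs_pos (b O t)). pose proof (Rabs_pos (flux g0 g1 a 0 t)). nra.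
Qed.

(** The recurrence has three terms, so the induction carries two consecutive components. *)
Lemma rw_odd_lim (g0 g1 : R) (a b : nat -> R -> R) (n : nat) :
  g0 <> 0 -> g1 <> 0 -> real_walk g0 g1 a b -> is_lim (b n) p_infty 0.
Proof.
  intros h0 h1 H.
  enough (is_lim (prev b n) p_infty 0 /\ is_lim (b n) p_infty 0) by tauto.
  induction n as [|n [IHp IH]]; split.
  - apply (is_lim_const 0).
  - eapply rw_first_odd_lim with (3 := H); auto.
  - exact IH.
  - pose proof (rw_dflux_lim _ _ _ _ n H IH) as Hd.
    (* The coefficients come from solving the formula of [dflux] for b_(n+1). *)
    pose proof (is_lim_lincomb_0 _ _ (- (g0 ^ 2 + g1 ^ 2) / (g0 * g1)) (-1) IH IHp) as Hl.
    pose proof (is_lim_lincomb_0 _ _ (1 / (g0 * g1)) 1 Hd Hl) as Hs.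
    eapply is_lim_ext; [|exact Hs]. intros t. unfold dflux. simpl. field. auto.
Qed.

(** * Geometric profile on the even sites *)

(** Induction on a_(n+1) = c_n / g1 - (g0 / g1) a_n, where the flux c_n tends to 0. *)
Lemma rw_even_geom_lim (g0 g1 : R) (a b : nat -> R -> R) (n : nat) :
  g0 <> 0 -> g1 <> 0 -> real_walk g0 g1 a b ->
  is_lim (fun t => a n t - (- (g0 / g1)) ^ n * a O t) p_infty 0.
Proof.
  intros h0 h1 H. induction n as [|n IH].
  - apply (is_lim_ext (fun _ => 0)); [intros; simpl; ring | apply (is_lim_const 0)].
  - pose proof (rw_flux_lim _ _ _ _ n H (rw_odd_lim _ _ _ _ n h0 h1 H)) as Hc.
    eapply is_lim_ext;
      [|exact (is_lim_lincomb_0 _ _ (1 / g1) (- (g0 / g1)) Hc IH)].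
    intros t. unfold flux. simpl. field. exact h1.
Qed.

Lemma rw_even_lim_of_first (g0 g1 : R) (a b : nat -> R -> R) (l : R) (n : nat) :
  g0 <> 0 -> g1 <> 0 -> real_walk g0 g1 a b -> is_lim (a O) p_infty l ->
  is_lim (a n) p_infty ((- (g0 / g1)) ^ n * l).
Proof.
  intros h0 h1 H Hl.
  eapply is_lim_ext; [|replace (_ ^ n * l) with (0 + (- (g0 / g1)) ^ n * l) by ring;
    apply is_lim_plus';
    [exact (rw_even_geom_lim _ _ _ _ n h0 h1 H)
    |exact (is_lim_scal_l _ ((- (g0 / g1)) ^ n) _ _ Hl)]].
  intros t. simpl. ring.
Qed.

(** With |r| >= 1 and d_n = a_n - r^n a_0, one has a_0^2 <= (r^n a_0)^2 <= 2 a_n^2 + 2 d_n^2.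
    Summing over n <= N bounds (N + 1) a_0^2 by 2 plus a vanishing term. *)
Lemma rw_first_even_lim_0 (g0 g1 : R) (a b : nat -> R -> R) :
  g0 <> 0 -> g1 <> 0 -> Rabs g1 <= Rabs g0 -> real_walk g0 g1 a b ->
  is_lim (a O) p_infty 0.
Proof.
  intros h0 h1 Hle H. apply is_lim_of_sqr_0.
  set (r := - (g0 / g1)).
  assert (Hr : forall n, 1 <= (r ^ n) ^ 2).
  { intros n. rewrite <- pow_mult, Nat.mul_comm, pow_mult. apply pow_R1_Rle.
    unfold r. rewrite <- pow2_abs, Rabs_Ropp, Rabs_div by assumption.
    pose proof (Rabs_pos_lt g1 h1).
    assert (1 <= Rabs g0 / Rabs g1) by (apply Rle_div_r; lra). nra. }
  set (d := fun n t => a n t - r ^ n * a O t).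
  assert (Hd : forall N, is_lim (fun t => sum_f_R0 (fun n => d n t ^ 2) N) p_infty 0).
  { intros N. apply (is_lim_sum_0 (fun n t => d n t ^ 2)). intros n.
    apply (is_lim_sqr_0 (d n)). exact (rw_even_geom_lim _ _ _ _ n h0 h1 H). }
  apply is_lim_spec. intros eps. pose proof (cond_pos eps) as He.
  (* 4 is twice the total mass 1 plus twice the bound 1 imposed on the sum of the d_n^2 at late
     times. *)
  destruct (INR_archimed eps 4 He) as [N HN].
  specialize (Hd N). apply is_lim_spec in Hd.
  destruct (Hd (mkposreal 1 Rlt_0_1)) as [M HM]. simpl in HM.
  exists (Rmax M 0). intros t Ht.
  pose proof (Rmax_l M 0). pose proof (Rmax_r M 0).
  specialize (HM t ltac:(lra)). rewrite Rminus_0_r in *. apply Rabs_def2 in HM.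
  pose proof (rw_norm _ _ _ _ H N t ltac:(lra)) as Hn.
  assert (Hs : INR (S N) * a O t ^ 2
    <= sum_f_R0 (fun n => (a n t ^ 2 + b n t ^ 2) * 2) N
       + sum_f_R0 (fun n => d n t ^ 2 * 2) N).
  { rewrite Rmult_comm, <- sum_cte, <- sum_plus. apply sum_Rle. intros n _.
    pose proof (Hr n).
    assert (a O t ^ 2 <= (r ^ n * a O t) ^ 2).
    { rewrite Rpow_mult_distr. pose proof (pow2_ge_0 (a O t)). nra. }
    replace (r ^ n * a O t) with (a n t - d n t) in * by (unfold d; ring).
    pose proof (pow2_ge_0 (a n t + d n t)). pose proof (pow2_ge_0 (b n t)). lra. }
  rewrite <- !scal_sum in Hs.
  pose proof (pow2_ge_0 (a O t)). rewrite Rabs_pos_eq by assumption.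
  pose proof (pos_INR N). rewrite S_INR in Hs.
  assert (INR N * a O t ^ 2 <= 4) by (simpl in *; lra).
  assert (0 < INR N) by nra.
  nra.
Qed.

(** * Overlap with the zero mode *)

(** As r g1 = - g0, the contributions of each b_n with n < N cancel between sites n and n + 1; only
    the cut at N leaks. *)
Lemma rw_overlap_derive (g0 g1 : R) (a b : nat -> R -> R) (N : nat) (t : R) :
  g1 <> 0 -> real_walk g0 g1 a b -> 0 < t ->
  is_derive (fun t => sum_f_R0 (fun n => (- (g0 / g1)) ^ n * a n t) N) t
    (g0 * (- (g0 / g1)) ^ N * b N t).
Proof.
  intros h1 H Ht. set (r := - (g0 / g1)).
  assert (Hr : r * g1 = - g0) by (unfold r; field; exact h1).
  induction N as [|N IH].
  - simpl sum_f_R0. evar_last.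
    + apply is_derive_scal. exact (rw_even _ _ _ _ H 0%nat t Ht).
    + simpl. ring.
  - simpl sum_f_R0. evar_last.
    + apply (is_derive_plus (fun t => sum_f_R0 (fun n => r ^ n * a n t) N)
        (fun t => r ^ S N * a (S N) t)); [exact IH|].
      apply is_derive_scal. exact (rw_even _ _ _ _ H (S N) t Ht).
    + unfold plus. simpl.
      transitivity (g0 * r ^ N * b N t + r ^ N * ((r * g1) * b N t)
        + r * r ^ N * g0 * b (S N) t); [ring|].
      rewrite Hr. ring.
Qed.

(** Initial data enter as right limits at 0, since [real_walk] speaks of positive times only. *)
Lemma rw_overlap_init (a : nat -> R -> R) (r alpha : R) (N : nat) :
  filterlim (a O) (at_right 0) (locally alpha) ->
  (forall n, filterlim (a (S n)) (at_right 0) (locally 0)) ->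
  filterlim (fun t => sum_f_R0 (fun n => r ^ n * a n t) N) (at_right 0) (locally alpha).
Proof.
  intros H0 HS. induction N as [|N IH]; simpl sum_f_R0.
  - apply (filterlim_ext (a O)); [intros; simpl; ring | exact H0].
  - replace alpha with (plus alpha (scal (r ^ S N) 0))
      by (unfold plus, scal; simpl; unfold mult; simpl; ring).
    refine (filterlim_comp_2 (G := locally alpha)
      (H := locally (scal (r ^ S N) 0)) _ _ plus IH _ _).
    + exact (filterlim_comp _ _ _ (a (S N)) (fun x => scal (r ^ S N) x) _ _ _ (HS N)
        (filterlim_scal_r (r ^ S N) 0)).
    + exact (filterlim_plus alpha (scal (r ^ S N) 0)).
Qed.

Lemma increment_le_at_right_0 (f : R -> R) (K alpha t : R) :
  filterlim f (at_right 0) (locally alpha) -> 0 <= K -> 0 < t ->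
  (forall s, 0 < s -> s <= t -> Rabs (f t - f s) <= K * (t - s)) ->
  Rabs (f t - alpha) <= K * t.
Proof.
  intros Hf HK Ht Hs. apply le_epsilon. intros eps He.
  destruct (Hf (fun y => Rabs (y - alpha) < eps)) as [del Hdel].
  { exists (mkposreal eps He). intros y Hy. exact Hy. }
  pose proof (cond_pos del) as Hdp.
  set (s := Rmin t (del / 2)).
  assert (Hs0 : 0 < s) by (unfold s; apply Rmin_glb_lt; lra).
  assert (Hst : s <= t) by apply Rmin_l.
  assert (Hsd : s <= del / 2) by apply Rmin_r.
  assert (H1 : Rabs (f s - alpha) < eps).
  { apply (Hdel s); [|exact Hs0]. apply Rabs_def1; unfold minus, plus, opp; simpl; lra. }
  specialize (Hs s Hs0 Hst).
  replace (f t - alpha) with ((f t - f s) + (f s - alpha)) by ring.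
  eapply Rle_trans; [apply Rabs_triang|]. nra.
Qed.

(* [(-g0/g1)^n] on the even sites is a zero mode of the Hamiltonian, so the full
   series [sum_n (-g0/g1)^n a_n] is conserved. *)
Lemma rw_overlap_le (g0 g1 : R) (a b : nat -> R -> R) (alpha : R) (N : nat) (t : R) :
  g1 <> 0 -> Rabs (g0 / g1) < 1 -> real_walk g0 g1 a b ->
  filterlim (a O) (at_right 0) (locally alpha) ->
  (forall n, filterlim (a (S n)) (at_right 0) (locally 0)) -> 0 < t ->
  Rabs (sum_f_R0 (fun n => (- (g0 / g1)) ^ n * a n t) N - alpha)
  <= Rabs (g0 / g1) ^ S N / (1 - Rabs (g0 / g1)).
Proof.
  intros h1 Hr H H0 HS Ht.
  rewrite <- (Rabs_Ropp (g0 / g1)) in *. set (r := - (g0 / g1)) in *.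
  set (L := fun M u => sum_f_R0 (fun n => r ^ n * a n u) M).
  (* This bound grows with [t], so it is used only at a cut M = N + k chosen after [t]; the
     geometric tail below then leads back to N uniformly in [t]. *)
  assert (Hdrift : forall M, Rabs (L M t - alpha) <= Rabs g0 * Rabs r ^ M * t).
  { intros M. apply increment_le_at_right_0; [| |exact Ht|].
    - apply rw_overlap_init; assumption.
    - apply Rmult_le_pos; [apply Rabs_pos | apply pow_le, Rabs_pos].
    - intros s Hs Hst.
      apply (derive_increment_le (L M) (fun u => g0 * r ^ M * b M u)); auto.
      + intros u Hu. apply rw_overlap_derive with (1 := h1) (2 := H) (3 := Hu).
      + intros u Hu. rewrite !Rabs_mult, <- RPow_abs.
        rewrite <- (Rmult_1_r (Rabs g0 * _)) at 2.
        apply Rmult_le_compat_l; [|eapply rw_odd_le; eauto].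
        apply Rmult_le_pos; [apply Rabs_pos | apply pow_le, Rabs_pos]. }
  assert (Htail : forall k, Rabs (L (N + k)%nat t - L N t)
    <= (Rabs r ^ S N - Rabs r ^ S (N + k)) / (1 - Rabs r)).
  { induction k as [|k IH].
    - rewrite Nat.add_0_r. unfold Rminus, Rdiv. rewrite !Rplus_opp_r, Rabs_R0. lra.
    - rewrite Nat.add_succ_r.
      replace (L (S (N + k)) t - L N t)
        with ((L (N + k)%nat t - L N t) + r ^ S (N + k) * a (S (N + k)) t)
        by (unfold L; simpl; ring).
      eapply Rle_trans; [apply Rabs_triang|].
      replace ((Rabs r ^ S N - Rabs r ^ S (S (N + k))) / (1 - Rabs r))
        with ((Rabs r ^ S N - Rabs r ^ S (N + k)) / (1 - Rabs r) + Rabs r ^ S (N + k))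
        by (simpl; field; lra).
      apply Rplus_le_compat; [exact IH|].
      rewrite Rabs_mult, <- RPow_abs.
      pose proof (rw_even_le _ _ _ _ (S (N + k)) t H Ht).
      pose proof (pow_le (Rabs r) (S (N + k)) (Rabs_pos r)). nra. }
  apply le_epsilon. intros eps He.
  assert (HgT : 0 <= Rabs g0 * t) by (pose proof (Rabs_pos g0); nra).
  destruct (pow_lt_1_zero r Hr (eps / (Rabs g0 * t + 1))) as [k Hk].
  { apply Rdiv_lt_0_compat; lra. }
  specialize (Hk (N + k)%nat ltac:(lia)). rewrite <- RPow_abs in Hk.
  apply Rlt_div_r in Hk; [|lra].
  specialize (Hdrift (N + k)%nat). specialize (Htail k).
  assert (Hpos := pow_le (Rabs r) (N + k) (Rabs_pos r)).
  replace (sum_f_R0 (fun n => r ^ n * a n t) N - alpha)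
    with ((L (N + k)%nat t - alpha) - (L (N + k)%nat t - L N t)) by (unfold L; ring).
  eapply Rle_trans; [apply Rabs_triang|]. rewrite Rabs_Ropp.
  assert ((Rabs r ^ S N - Rabs r ^ S (N + k)) / (1 - Rabs r)
    <= Rabs r ^ S N / (1 - Rabs r)).
  { apply Rmult_le_compat_r; [left; apply Rinv_0_lt_compat; lra|].
    pose proof (pow_le (Rabs r) (S (N + k)) (Rabs_pos r)). lra. }
  nra.
Qed.

Lemma sum_geom_sqr (r : R) (N : nat) :
  (1 - r ^ 2) * sum_f_R0 (fun n => r ^ n * r ^ n) N = 1 - (r ^ S N) ^ 2.
Proof.
  induction N as [|N IH]; simpl sum_f_R0.
  - simpl. ring.
  - rewrite Rmult_plus_distr_l, IH. simpl. ring.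
Qed.

(** The truncated overlap is near [alpha] by conservation, and near a_0 times the sum of the r^(2n)
    by the geometric profile. Multiplying by 1 - r^2 isolates a_0. The cut N is fixed first, then
    [t] is taken large. *)
Lemma rw_first_even_lim (g0 g1 : R) (a b : nat -> R -> R) (alpha : R) :
  g0 <> 0 -> g1 <> 0 -> Rabs (g0 / g1) < 1 -> real_walk g0 g1 a b ->
  filterlim (a O) (at_right 0) (locally alpha) ->
  (forall n, filterlim (a (S n)) (at_right 0) (locally 0)) ->
  is_lim (a O) p_infty (alpha * (1 - (g0 / g1) ^ 2)).
Proof.
  intros h0 h1 Hr H H0 HS.
  set (r := - (g0 / g1)). set (x := Rabs (g0 / g1)) in *.
  assert (Hx0 : 0 <= x) by apply Rabs_pos.
  assert (Hxr : (g0 / g1) ^ 2 = x ^ 2) by (unfold x; now rewrite pow2_abs).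
  assert (Hrx : r ^ 2 = x ^ 2) by (rewrite <- Hxr; unfold r; ring).
  set (D := fun N t => sum_f_R0 (fun n => r ^ n * (a n t - r ^ n * a O t)) N).
  assert (HD : forall N, is_lim (D N) p_infty 0).
  { intros N. apply (is_lim_sum_0 (fun n t => r ^ n * (a n t - r ^ n * a O t))).
    intros n. replace (Finite 0) with (Rbar_mult (r ^ n) 0) by (simpl; f_equal; ring).
    apply is_lim_scal_l. exact (rw_even_geom_lim _ _ _ _ n h0 h1 H). }
  apply is_lim_spec. intros eps. pose proof (cond_pos eps) as He.
  (* The errors of size x^(N+1): 1 / (1 - x) from the overlap tail, and 1 from truncating the
     geometric sum. *)
  set (c := 1 / (1 - x) + 1).
  assert (Hc : 0 < c).
  { unfold c. assert (0 < 1 / (1 - x)) by (apply Rdiv_lt_0_compat; lra). lra. }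
  destruct (pow_lt_1_zero x ltac:(rewrite Rabs_pos_eq; lra) (eps / 2 / c)) as [N HN].
  { apply Rdiv_lt_0_compat; lra. }
  specialize (HN (S N) ltac:(lia)).
  assert (Hxn : 0 <= x ^ S N) by (apply pow_le; exact Hx0).
  assert (Hxn1 : x ^ S N <= 1) by (rewrite <- (pow1 (S N)); apply pow_incr; lra).
  rewrite Rabs_pos_eq in HN by exact Hxn. apply Rlt_div_r in HN; [|exact Hc].
  specialize (HD N). apply is_lim_spec in HD.
  destruct (HD (mkposreal (eps / 2) ltac:(lra))) as [M HM]. simpl in HM.
  exists (Rmax M 0). intros t Ht.
  pose proof (Rmax_l M 0). pose proof (Rmax_r M 0).
  specialize (HM t ltac:(lra)). rewrite Rminus_0_r in HM.
  pose proof (rw_overlap_le _ _ _ _ alpha N t h1 Hr H H0 HS ltac:(lra)) as HL.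
  pose proof (rw_even_le _ _ _ _ 0 t H ltac:(lra)) as Ha.
  fold x r in HL. set (L := sum_f_R0 (fun n => r ^ n * a n t) N) in *.
  assert (HLD : (1 - r ^ 2) * (L - D N t) = (1 - (r ^ S N) ^ 2) * a O t).
  { rewrite <- sum_geom_sqr.
    replace (L - D N t) with (a O t * sum_f_R0 (fun n => r ^ n * r ^ n) N); [ring|].
    unfold L, D. rewrite scal_sum, <- minus_sum. apply sum_eq. intros; ring. }
  assert (Hrn : (r ^ S N) ^ 2 = (x ^ S N) ^ 2).
  { rewrite <- !pow_mult, !(Nat.mul_comm (S N)), !pow_mult, Hrx. reflexivity. }
  rewrite Hrn, Hrx in HLD. rewrite Hxr.
  replace (a O t - alpha * (1 - x ^ 2))
    with ((1 - x ^ 2) * ((L - alpha) - D N t) + (x ^ S N) ^ 2 * a O t) by lra.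
  assert (Hx2 : 0 <= 1 - x ^ 2 <= 1) by nra.
  assert (HA : Rabs ((1 - x ^ 2) * (L - alpha - D N t))
    <= x ^ S N / (1 - x) + Rabs (D N t)).
  { rewrite Rabs_mult, (Rabs_pos_eq (1 - x ^ 2)) by lra.
    pose proof (Rabs_triang (L - alpha) (- D N t)) as Htr. rewrite Rabs_Ropp in Htr.
    fold (L - alpha - D N t) in Htr.
    pose proof (Rabs_pos (L - alpha - D N t)). nra. }
  assert (HB : Rabs ((x ^ S N) ^ 2 * a O t) <= x ^ S N).
  { rewrite Rabs_mult, (Rabs_pos_eq ((x ^ S N) ^ 2)) by nra.
    pose proof (Rabs_pos (a O t)). nra. }
  assert (HC : x ^ S N * c = x ^ S N / (1 - x) + x ^ S N) by (unfold c; field; lra).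
  eapply Rle_lt_trans; [apply Rabs_triang|]. lra.
Qed.

(** * From complex amplitudes to the real system *)

(** At a positive time the half line is a neighbourhood, so the one-sided restriction disappears. *)
Lemma time_derive_locally (f : R -> C) (t : R) (d : C) :
  0 < t -> is_time_derive f t d ->
  filterdiff (U := R_NormedModule) (V := C_R_NormedModule)
    f (locally t) (fun h => scal h d).
Proof.
  intros Ht [Hlin Hdom]. split; [exact Hlin|]. intros x Hx eps.
  assert (Hx' : is_filter_lim (within (fun s => 0 <= s) (locally t)) x).
  { intros P HP. unfold within. generalize (Hx P HP). apply filter_imp. auto. }
  pose proof (Hdom x Hx' eps) as Heps. unfold within in Heps.
  generalize (filter_and _ _ Heps (open_gt 0 t Ht)).
  apply filter_imp. intros y [Hy Hy0]. apply Hy. apply Rlt_le. exact Hy0.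
Qed.

Lemma i_ddt_parts (f : R -> C) (t : R) (v : C) :
  0 < t -> i_ddt_is f t v ->
  is_derive (fun s => Re (f s)) t (Im v) /\
  is_derive (fun s => Im (f s)) t (- Re v).
Proof.
  intros Ht [d [Hd <-]]. apply time_derive_locally in Hd; [|exact Ht].
  pose proof (filterdiff_comp' f fst t _ _ Hd
    (filterdiff_linear _ is_linear_fst)) as H1.
  pose proof (filterdiff_comp' f snd t _ _ Hd
    (filterdiff_linear _ is_linear_snd)) as H2.
  split.
  - replace (Im (Ci * d)) with (Re d) by (unfold Im, Re; simpl; ring). exact H1.
  - replace (- Re (Ci * d)) with (Im d) by (unfold Im, Re; simpl; ring). exact H2.
Qed.

(** Differentiability at 0 relative to the half line ties the positive times to the initial
    state. *)
Lemma i_ddt_right_continuous (f : R -> C) (v : C) :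
  i_ddt_is f 0 v ->
  filterlim (fun s => Re (f s)) (at_right 0) (locally (Re (f 0))) /\
  filterlim (fun s => Im (f s)) (at_right 0) (locally (Im (f 0))).
Proof.
  intros [d [Hd _]].
  assert (Hf : filterlim f (at_right 0) (locally (f 0))).
  { assert (Hc : filterlim f
      (within (fun s => 0 <= s) (locally 0)) (locally (f 0))).
    { apply (filterdiff_continuous_aux (U := R_NormedModule) (V := C_R_NormedModule)).
      - eexists. exact Hd.
      - intros P HP. unfold within. generalize HP. apply filter_imp. auto. }
    intros P HP. generalize (Hc P HP). unfold filtermap, at_right, within.
    apply filter_imp.
    intros x Hx Hx0. apply Hx, Rlt_le, Hx0. }
  split.
  - exact (filterlim_comp _ _ _ f fst _ _ _ Hf
      (continuous_fst (U := R_UniformSpace) (V := R_UniformSpace) _ _)).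
  - exact (filterlim_comp _ _ _ f snd _ _ _ Hf
      (continuous_snd (U := R_UniformSpace) (V := R_UniformSpace) _ _)).
Qed.

Lemma sum_even_odd (u : nat -> R) (N : nat) :
  sum_f_R0 (fun n => u (2 * n)%nat + u (2 * n + 1)%nat) N
  = sum_f_R0 u (2 * N + 1).
Proof.
  induction N as [|N IH]; [reflexivity|].
  replace (2 * S N + 1)%nat with (S (S (2 * N + 1))) by lia.
  rewrite !tech5, IH.
  replace (2 * S N)%nat with (S (2 * N + 1)) by lia.
  replace (S (2 * N + 1) + 1)%nat with (S (S (2 * N + 1))) by lia. ring.
Qed.

Lemma Cmod_sqr (z : C) : Cmod z ^ 2 = Re z ^ 2 + Im z ^ 2.
Proof. unfold Cmod. rewrite pow2_sqrt; [reflexivity|]. unfold Re, Im. nra. Qed.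

Lemma ctqw_sum_le (g0 g1 : R) (psi : R -> nat -> C) (N : nat) (t : R) :
  is_ctqw g0 g1 psi -> 0 < t ->
  sum_f_R0 (fun n => Cmod (psi t (2 * n)%nat) ^ 2
                     + Cmod (psi t (2 * n + 1)%nat) ^ 2) N <= 1.
Proof.
  intros H Ht. rewrite (sum_even_odd (fun x => Cmod (psi t x) ^ 2)).
  pose proof (ctqw_norm _ _ _ H t (Rlt_le _ _ Ht)) as Hn.
  apply sum_incr.
  - apply is_series_Reals in Hn. exact Hn.
  - intros n. apply pow2_ge_0.
Qed.

Lemma ctqw_even_parts (g0 g1 : R) (psi : R -> nat -> C) (n : nat) (t : R) :
  is_ctqw g0 g1 psi -> 0 < t ->
  is_derive (fun s => Re (psi s (2 * n)%nat)) t
    (g1 * prev (fun m s => Im (psi s (2 * m + 1)%nat)) n t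
     + g0 * Im (psi t (2 * n + 1)%nat)) /\
  is_derive (fun s => Im (psi s (2 * n)%nat)) t
    (g1 * prev (fun m s => - Re (psi s (2 * m + 1)%nat)) n t
     + g0 * - Re (psi t (2 * n + 1)%nat)).
Proof.
  intros H Ht. destruct n as [|n].
  - destruct (i_ddt_parts _ _ _ Ht (ctqw_zero _ _ _ H t (Rlt_le _ _ Ht))) as [H1 H2].
    split; evar_last; [exact H1| |exact H2|]; unfold Re, Im; simpl; ring.
  - destruct (i_ddt_parts _ _ _ Ht
      (ctqw_even _ _ _ H t (Rlt_le _ _ Ht) (S n) ltac:(lia))) as [H1 H2].
    replace (2 * S n - 1)%nat with (2 * n + 1)%nat in H1, H2 by lia.
    split; evar_last; [exact H1| |exact H2|]; unfold Re, Im, prev; simpl; ring.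
Qed.

Lemma ctqw_odd_parts (g0 g1 : R) (psi : R -> nat -> C) (n : nat) (t : R) :
  is_ctqw g0 g1 psi -> 0 < t ->
  is_derive (fun s => Re (psi s (2 * n + 1)%nat)) t
    (g0 * Im (psi t (2 * n)%nat) + g1 * Im (psi t (2 * S n)%nat)) /\
  is_derive (fun s => Im (psi s (2 * n + 1)%nat)) t
    (- (g0 * Re (psi t (2 * n)%nat) + g1 * Re (psi t (2 * S n)%nat))).
Proof.
  intros H Ht.
  destruct (i_ddt_parts _ _ _ Ht
    (ctqw_odd _ _ _ H t (Rlt_le _ _ Ht) n)) as [H1 H2].
  replace (2 * S n)%nat with (2 * n + 2)%nat by lia.
  split; evar_last; [exact H1| |exact H2|]; unfold Re, Im; simpl; ring.
Qed.

(** The Hamiltonian is real and links even sites to odd ones only, so real parts on even sites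
    couple only to imaginary parts on odd sites. *)
Lemma ctqw_real_part (g0 g1 : R) (psi : R -> nat -> C) :
  is_ctqw g0 g1 psi ->
  real_walk g0 g1 (fun n t => Re (psi t (2 * n)%nat))
    (fun n t => Im (psi t (2 * n + 1)%nat)).
Proof.
  intros H. split.
  - intros n t Ht. apply (ctqw_even_parts _ _ _ n t H Ht).
  - intros n t Ht. apply (ctqw_odd_parts _ _ _ n t H Ht).
  - intros N t Ht. eapply Rle_trans; [|exact (ctqw_sum_le _ _ _ N t H Ht)].
    apply sum_Rle. intros n _. rewrite !Cmod_sqr.
    pose proof (pow2_ge_0 (Im (psi t (2 * n)%nat))).
    pose proof (pow2_ge_0 (Re (psi t (2 * n + 1)%nat))). lra.
Qed.

(** The same decomposition applied to -i psi, which explains the minus sign. *)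
Lemma ctqw_imag_part (g0 g1 : R) (psi : R -> nat -> C) :
  is_ctqw g0 g1 psi ->
  real_walk g0 g1 (fun n t => Im (psi t (2 * n)%nat))
    (fun n t => - Re (psi t (2 * n + 1)%nat)).
Proof.
  intros H. split.
  - intros n t Ht. apply (ctqw_even_parts _ _ _ n t H Ht).
  - intros n t Ht. apply is_derive_opp with (f := fun s => Re (psi s (2 * n + 1)%nat)).
    apply (ctqw_odd_parts _ _ _ n t H Ht).
  - intros N t Ht. eapply Rle_trans; [|exact (ctqw_sum_le _ _ _ N t H Ht)].
    apply sum_Rle. intros n _. rewrite !Cmod_sqr.
    pose proof (pow2_ge_0 (Re (psi t (2 * n)%nat))).
    pose proof (pow2_ge_0 (Im (psi t (2 * n + 1)%nat))). lra.
Qed.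

Lemma ctqw_even_right_continuous (g0 g1 : R) (psi : R -> nat -> C) (n : nat) :
  is_ctqw g0 g1 psi ->
  filterlim (fun t => Re (psi t (2 * n)%nat)) (at_right 0)
    (locally (Re (psi 0 (2 * n)%nat))) /\
  filterlim (fun t => Im (psi t (2 * n)%nat)) (at_right 0)
    (locally (Im (psi 0 (2 * n)%nat))).
Proof.
  intros H. destruct n as [|n].
  - exact (i_ddt_right_continuous _ _ (ctqw_zero _ _ _ H 0 (Rle_refl 0))).
  - exact (i_ddt_right_continuous _ _
      (ctqw_even _ _ _ H 0 (Rle_refl 0) (S n) ltac:(lia))).
Qed.

(** * Assembling the limits *)

Lemma is_lim_prob (psi : R -> nat -> C) (x : nat) (l m : R) :
  is_lim (fun t => Re (psi t x)) p_infty l ->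
  is_lim (fun t => Im (psi t x)) p_infty m ->
  is_lim (fun t => prob_position psi t x) p_infty (l ^ 2 + m ^ 2).
Proof.
  intros Hl Hm.
  apply (is_lim_ext (fun t => Re (psi t x) ^ 2 + Im (psi t x) ^ 2)).
  { intros t. symmetry. apply Cmod_sqr. }
  assert (Hsq : forall y : R, continuous (fun x => x ^ 2) y).
  { intros y. apply (ex_derive_continuous (fun x => x ^ 2)). auto_derive. exact I. }
  apply is_lim_plus'.
  - exact (is_lim_comp_continuous _ (fun x => x ^ 2) _ _ Hl (Hsq l)).
  - exact (is_lim_comp_continuous _ (fun x => x ^ 2) _ _ Hm (Hsq m)).
Qed.

Theorem theorem1 (g0 g1 : R) (hg0 : g0 <> 0) (hg1 : g1 <> 0)
    (psi : R -> nat -> C) (hpsi : is_ctqw g0 g1 psi)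
    (hinit : starts_at_origin psi) (n : nat) :
  is_lim (fun t => prob_position psi t (2 * n)%nat) p_infty
    (Finite (if Rlt_dec (Rabs g0) (Rabs g1)
             then (1 - (g0 / g1) ^ 2) ^ 2 * (g0 / g1) ^ (2 * n)
             else 0)) /\
  is_lim (fun t => prob_position psi t (2 * n + 1)%nat) p_infty (Finite 0).
Proof.
  pose proof (ctqw_real_part _ _ _ hpsi) as Hre.
  pose proof (ctqw_imag_part _ _ _ hpsi) as Him.
  (* In both regimes the imaginary part at the origin tends to 0, so one formula in the real limit
     [l] serves both; squaring removes the sign of - g0 / g1. *)
  assert (Hlims : forall l : R, 
    is_lim (fun t => Re (psi t (2 * 0)%nat)) p_infty l ->
    is_lim (fun t => Im (psi t (2 * 0)%nat)) p_infty 0 ->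
    is_lim (fun t => prob_position psi t (2 * n)%nat) p_infty
      (l ^ 2 * (g0 / g1) ^ (2 * n))).
  { intros l Hl Hm.
    apply (rw_even_lim_of_first _ _ _ _ _ n hg0 hg1 Hre) in Hl.
    apply (rw_even_lim_of_first _ _ _ _ _ n hg0 hg1 Him) in Hm.
    pose proof (is_lim_prob _ _ _ _ Hl Hm) as Hp.
    replace (l ^ 2 * (g0 / g1) ^ (2 * n))
      with (((- (g0 / g1)) ^ n * l) ^ 2 + ((- (g0 / g1)) ^ n * 0) ^ 2); [exact Hp|].
    rewrite pow_mult.
    replace ((g0 / g1) ^ 2) with ((- (g0 / g1)) ^ 2) by ring.
    rewrite <- pow_mult, Nat.mul_comm, pow_mult. ring. }
  destruct hinit as [Hone Hzero]. split.
  - destruct (Rlt_dec (Rabs g0) (Rabs g1)) as [Hlt | Hge].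
    + assert (Hr : Rabs (g0 / g1) < 1).
      { pose proof (Rabs_pos_lt g1 hg1). rewrite Rabs_div by assumption.
        apply Rlt_div_l; lra. }
      assert (HS : forall m, psi 0 (2 * S m)%nat = RtoC 0) by (intros; apply Hzero; lia).
      replace (1 - (g0 / g1) ^ 2) with (1 * (1 - (g0 / g1) ^ 2)) by ring.
      apply Hlims.
      * apply (rw_first_even_lim _ _ _ _ 1 hg0 hg1 Hr Hre).
        -- pose proof (proj1 (ctqw_even_right_continuous _ _ _ 0 hpsi)) as Hc.
           simpl Nat.mul in Hc. rewrite Hone in Hc. exact Hc.
        -- intros m. pose proof (proj1 (ctqw_even_right_continuous _ _ _ (S m) hpsi)) as Hc.
           rewrite HS in Hc. exact Hc.
      (* The initial amplitude 1 has imaginary part 0, so here the conserved overlap is 0. *)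
      * replace (Finite 0) with (Finite (0 * (1 - (g0 / g1) ^ 2))) by (f_equal; ring).
        apply (rw_first_even_lim _ _ _ _ 0 hg0 hg1 Hr Him).
        -- pose proof (proj2 (ctqw_even_right_continuous _ _ _ 0 hpsi)) as Hc.
           simpl Nat.mul in Hc. rewrite Hone in Hc. exact Hc.
        -- intros m. pose proof (proj2 (ctqw_even_right_continuous _ _ _ (S m) hpsi)) as Hc.
           rewrite HS in Hc. exact Hc.
    + apply Rnot_lt_le in Hge.
      replace (Finite 0) with (Finite (0 ^ 2 * (g0 / g1) ^ (2 * n))) by (f_equal; ring).
      apply Hlims.
      * exact (rw_first_even_lim_0 _ _ _ _ hg0 hg1 Hge Hre).
      * exact (rw_first_even_lim_0 _ _ _ _ hg0 hg1 Hge Him).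
  (* The factor -1 undoes the sign in the odd component of [ctqw_imag_part]. *)
  - replace (Finite 0) with (Finite ((-1 * 0) ^ 2 + 0 ^ 2)) by (f_equal; ring).
    apply is_lim_prob.
    + eapply is_lim_ext; [|exact (is_lim_scal_l _ (-1) _ _ (rw_odd_lim _ _ _ _ n hg0 hg1 Him))].
      intros t. simpl. ring.
    + exact (rw_odd_lim _ _ _ _ n hg0 hg1 Hre).
Qed.
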